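(* Let $n = p^k m^2$ be an odd perfect number, where $p$ is prime, $p \equiv k \equiv 1 \pmod 4$ and $\gcd(p,m)=1$. Then: (1) If $p \equiv k \equiv 1 \pmod 8$, then $\sigma(m^2) \equiv 3 \pmod 4$ is impossible. (2) If $p \equiv 1 \pmod 8$ and $k \equiv 5 \pmod 8$, then $\sigma(m^2) \equiv 1 \pmod 4$ is impossible. (3) If $p \equiv 5 \pmod 8$ and $k \equiv 1 \pmod 8$, then $\sigma(m^2) \equiv 1 \pmod 4$ is impossible. (4) If $p \equiv k \equiv 5 \pmod 8$, then $\sigma(m^2) \equiv 3 \pmod 4$ is impossible.
   Context: $\sigma(z)$ denotes the sum of the positive divisors of $z$. An odd perfect number is an odd positive integer $n$ with $\sigma(n) = 2n$. By Euler, any odd perfect number has the form $n = p^k m^2$ with $p$ prime, $p \equiv k \equiv 1 \pmod 4$ and $\gcd(p,m)=1$; $p$ is called the special prime. *)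

(* Defs.v *)
From mathcomp Require Import all_boot.

Set Implicit Arguments.
Unset Strict Implicit.
Unset Printing Implicit Defensive.

(* [divisors 0 = [:: 1]], so [sigma 0 = 1] is a junk value; [sigma] is only
   meaningful on positive arguments. *)
Definition sigma (z : nat) : nat := \sum_(d <- divisors z) d.

(* Positivity is implied by oddness. *)
Definition odd_perfect (n : nat) : Prop := odd n /\ sigma n = 2 * n.

(* Main.v *)
Require Import Defs.
From mathcomp Require Import all_boot.
From mathcomp Require Import zify.

(** By multiplicativity, [sigma (p ^ k) * sigma (m ^ 2) = 2 * p ^ k * m ^ 2].
    Pairing consecutive powers, [sigma (p ^ k)] is [1 + p] times a sum of
    [(k + 1) / 2] powers of [p ^ 2], each of which is [1] modulo [8].  Since
    [p ^ k] is [p] and [m ^ 2] is [1] modulo [8], this leaves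
    [(1 + p) * ((k + 1) / 2) * sigma (m ^ 2) = 2 * p] modulo [8]; as [1 + p] is
    twice an odd number, it determines [sigma (m ^ 2)] modulo [4]. *)

Lemma perm_divisorsM (a b : nat) : 0 < a -> 0 < b -> coprime a b ->
  perm_eq (divisors (a * b)) [seq x * y | x <- divisors a, y <- divisors b].
Proof.
move=> a_gt0 b_gt0 co_ab; apply: uniq_perm; first exact: divisors_uniq.
  apply: allpairs_uniq => [||[x y] [x' y']]; try exact: divisors_uniq.
  case/allpairsP=> -[x1 y1] /= [x_a y_b [-> ->]].
  case/allpairsP=> -[x2 y2] /= [x'_a y'_b [-> ->]] eq_xy.
  move: x_a y_b x'_a y'_b; rewrite -!dvdn_divisors // => x_a y_b x'_a y'_b.
  (* Coprimality lets the factor dividing [a] be recovered from the product as a gcd, so distinct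
     pairs have distinct products. *)
  have recover u v : u %| a -> v %| b -> gcdn a (u * v) = u.
    move=> u_a v_b; rewrite Gauss_gcdl; last exact: coprime_dvdr co_ab.
    exact/gcdn_idPr.
  have eq_x : x1 = x2 by rewrite -(recover x1 y1) // eq_xy recover.
  congr (_, _) => //; apply/eqP; rewrite -(@eqn_pmul2l x1) ?(dvdn_gt0 _ x_a) //.
  by rewrite eq_xy eq_x.
move=> d; rewrite -dvdn_divisors ?muln_gt0 ?a_gt0 //.
apply/idP/allpairsP => [d_ab | [[x y] /= [x_a y_b ->]]]; last first.
  by move: x_a y_b; rewrite -!dvdn_divisors //; apply: dvdn_mul.
(* The witness is the gcd of [d] with [a] and its cofactor: the cofactor is coprime to what remains
   of [a], hence divides [b]. *)
have x_gt0 : 0 < gcdn d a by rewrite gcdn_gt0 a_gt0 orbT.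
have x_d := dvdn_gcdl d a; have x_a := dvdn_gcdr d a.
exists (gcdn d a, d %/ gcdn d a); rewrite /= -!dvdn_divisors //.
split=> //; last by rewrite mulnC divnK.
have co_da : coprime (d %/ gcdn d a) (a %/ gcdn d a).
  by rewrite /coprime -(@eqn_pmul2r (gcdn d a)) // muln_gcdl !divnK // mul1n.
rewrite -(Gauss_dvdr _ co_da) -(@dvdn_pmul2r (gcdn d a)) //.
by rewrite mulnAC !divnK.
Qed.

Lemma sigmaM (a b : nat) : 0 < a -> 0 < b -> coprime a b ->
  sigma (a * b) = sigma a * sigma b.
Proof.
move=> a_gt0 b_gt0 co_ab; rewrite /sigma (perm_big _ (perm_divisorsM a b _ _ _)) //=.
rewrite big_allpairs_dep big_distrl; apply: eq_bigr => x _.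
by rewrite big_distrr.
Qed.

Lemma sigma_pfactor (p k : nat) : prime p ->
  sigma (p ^ k) = \sum_(i < k.+1) p ^ i.
Proof.
move=> p_pr; have p_gt1 := prime_gt1 p_pr.
rewrite -(big_mkord xpredT (expn p)).
rewrite -[RHS](big_map (expn p) xpredT (fun d => d)).
apply: perm_big; apply: uniq_perm; first exact: divisors_uniq.
  by rewrite map_inj_uniq ?iota_uniq //; apply: expnI.
move=> d; rewrite -dvdn_divisors ?expn_gt0 ?prime_gt0 //.
apply/dvdn_pfactor/mapP => // -[i].
  by move=> i_le ->; exists i; rewrite // mem_index_iota.
by rewrite mem_index_iota => i_lt ->; exists i.
Qed.

Lemma sum_expn_double (p j : nat) :
  \sum_(i < j.*2) p ^ i = p.+1 * \sum_(i < j) (p ^ 2) ^ i.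
Proof.
elim: j => [|j IHj]; first by rewrite !big_ord0 muln0.
rewrite doubleS !big_ord_recr /= IHj -(expnM p 2 j) mul2n mulnDr.
by rewrite -addnA (expnS p j.*2) -mulSn.
Qed.

Lemma odd_sqr_mod8 (x : nat) : odd x -> x ^ 2 = 1 %[mod 8].
Proof.
move=> odd_x; rewrite -modnXm.
have: odd (x %% 8) by rewrite odd_mod.
have: x %% 8 < 8 by rewrite ltn_mod.
by case: (x %% 8) => [|[|[|[|[|[|[|[|r]]]]]]]].
Qed.

Lemma odd_expn_mod8 (x j : nat) : odd x -> (x ^ 2) ^ j = 1 %[mod 8].
Proof. by move=> odd_x; rewrite -modnXm odd_sqr_mod8 // modnXm exp1n. Qed.

Lemma sum_odd_expn_mod8 (x j : nat) : odd x ->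
  \sum_(i < j) (x ^ 2) ^ i = j %[mod 8].
Proof.
move=> odd_x; rewrite -modn_summ (eq_bigr (fun=> 1)) => [|i _].
  by rewrite sum1_card card_ord.
by rewrite odd_expn_mod8.
Qed.

(** The odd exponent is written [j.*2.+1] so that the powers of [p] in its sigma form exactly [j.+1]
    consecutive pairs. *)
Lemma perfect_sigma_mod8 (p j m : nat) : prime p -> odd p -> odd m ->
  coprime p m ->
  sigma (p ^ j.*2.+1 * m ^ 2) = 2 * (p ^ j.*2.+1 * m ^ 2) ->
  p.+1 * j.+1 * sigma (m ^ 2) = 2 * p %[mod 8].
Proof.
move=> p_pr odd_p odd_m co_pm.
rewrite sigmaM ?expn_gt0 ?(prime_gt0 p_pr) ?(odd_gt0 odd_m) //; last first.
  by rewrite coprimeXl ?coprimeXr.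
rewrite sigma_pfactor // -doubleS sum_expn_double => perfect.
(* Modulo 8, [j.+1] is traded back for the sum of powers of [p ^ 2], which makes the left side the
   exact product in [perfect]. *)
rewrite -modnMml -[_ * j.+1 %% 8]modnMmr -(@sum_odd_expn_mod8 p j.+1 odd_p).
rewrite modnMmr modnMml perfect expnS -mul2n expnM !(mulnA 2).
rewrite -modnMmr odd_sqr_mod8 // modnMmr muln1.
by rewrite -modnMmr odd_expn_mod8 // modnMmr muln1.
Qed.

Theorem theorem2 (n p k m : nat)
    (n_perfect : odd_perfect n) (n_def : n = p ^ k * m ^ 2)
    (p_prime : prime p) (p_mod4 : p = 1 %[mod 4]) (k_mod4 : k = 1 %[mod 4])
    (pm_coprime : coprime p m) :
  [/\ p = 1 %[mod 8] -> k = 1 %[mod 8] -> ~ (sigma (m ^ 2) = 3 %[mod 4]),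
      p = 1 %[mod 8] -> k = 5 %[mod 8] -> ~ (sigma (m ^ 2) = 1 %[mod 4]),
      p = 5 %[mod 8] -> k = 1 %[mod 8] -> ~ (sigma (m ^ 2) = 1 %[mod 4])
    & p = 5 %[mod 8] -> k = 5 %[mod 8] -> ~ (sigma (m ^ 2) = 3 %[mod 4])].
Proof.
have [odd_n perfect_n] := n_perfect.
have odd_m : odd m by move: odd_n; rewrite n_def oddM !oddX /= => /andP[].
have odd_p : odd p by lia.
have k_eq : k = k./2.*2.+1 by lia.
move: perfect_n; rewrite n_def k_eq => /perfect_sigma_mod8.
move=> /(_ p_prime odd_p odd_m pm_coprime).
set s := sigma _; set j := k./2 in k_eq *; clearbody s j.
clear - k_eq => key.
(* Since [p.+1] is even, [j] and [s] matter only modulo 4. With literal remainders, every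
   nonconstant term of the expansion is a multiple of 8, so [lia] can treat the nonlinear monomials
   as atoms. *)
have residue u v w : p %% 8 = u -> j %% 4 = v -> s %% 4 = w ->
    (p %/ 8 * 8 + u).+1 * (j %/ 4 * 4 + v).+1 * (s %/ 4 * 4 + w) =
      2 * (p %/ 8 * 8 + u) %[mod 8].
  by move=> <- <- <-; rewrite -!divn_eq.
(* As [k] is [j.*2.+1], the residues 1 and 5 of [k] modulo 8 give 0 and 2 for [j] modulo 4. In all
   four cases the left side is 6 modulo 8 and the right side is 2. *)
split=> p8 k8 s4.
- by have := residue 1 0 3 p8 ltac:(lia) s4; lia.
- by have := residue 1 2 1 p8 ltac:(lia) s4; lia.
- by have := residue 5 0 1 p8 ltac:(lia) s4; lia.
- by have := residue 5 2 3 p8 ltac:(lia) s4; lia.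
Qed.
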